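(* Let $\ell$-free notation be as follows: for integers $m\ge0$ and $N\ge1$, let $L(m,N)$ be the number of partitions of $N$ into $m$ parts whose largest part, say $n$, appears at least $n$ times, and let $R(k,N)$ be the number of Rogers--Ramanujan partitions of $N$ with rank $k$. Then $L(m,N)=R(m-1,N)$.
   Context: A Rogers--Ramanujan partition is a partition in which any two parts differ by at least $2$. The rank of a partition is its largest part minus its number of parts. *)

(* Defs.v *)
From HB Require Import structures.
From mathcomp Require Import all_boot all_order all_algebra.

Set Implicit Arguments.
Unset Strict Implicit.
Unset Printing Implicit Defensive.

Import GRing.Theory.

Definition is_intpart (N : nat) (s : seq nat) : bool :=
  [&& sorted geq s, 0 \notin s & sumn s == N].

Record intpart (N : nat) := IntPart {
  parts :> seq nat;
  _ : is_intpart N parts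
}.

HB.instance Definition _ N := [isSub for @parts N].
HB.instance Definition _ N := [Countable of intpart N by <:].

(* Finiteness of [intpart N]: a partition of N has at most N parts, each at
   most N, so it embeds into [N.-bseq 'I_N.+1]. *)
Section IntPartFinite.
Variable N : nat.

Lemma size_le_sumn (s : seq nat) : 0 \notin s -> size s <= sumn s.
Proof.
elim: s => //= x s IHs; rewrite inE negb_or eq_sym -lt0n => /andP[x_gt0 s0].
by rewrite -add1n leq_add ?IHs.
Qed.

Lemma size_intpart (p : intpart N) : size p <= N.
Proof. by case: p => s /= /and3P[_ s0 /eqP <-]; apply: size_le_sumn. Qed.

Lemma intpart_le (p : intpart N) x : x \in parts p -> x <= N.
Proof.
case: p => s /= /and3P[_ _ /eqP <-].
elim: s => //= y s IHs; rewrite inE => /predU1P[->|/IHs xs].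
  exact: leq_addr.
exact: leq_trans xs (leq_addl _ _).
Qed.

Definition bseq_of_intpart (p : intpart N) : N.-bseq 'I_N.+1 :=
  insub_bseq N [seq inord x | x <- p].

Definition intpart_of_bseq (b : N.-bseq 'I_N.+1) : option (intpart N) :=
  insub [seq val i | i <- b].

Lemma bseq_of_intpartK : pcancel bseq_of_intpart intpart_of_bseq.
Proof.
move=> p; rewrite /intpart_of_bseq /bseq_of_intpart /insub_bseq.
have sz : size [seq inord x : 'I_N.+1 | x <- p] <= N.
  by rewrite size_map size_intpart.
rewrite insubdK; last by rewrite unfold_in.
have -> : [seq val i | i <- [seq inord x : 'I_N.+1 | x <- p]] = p.
  rewrite -map_comp; apply: map_id_in => x /intpart_le xN.
  by rewrite /= inordK.
exact: valK.
Qed.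

HB.instance Definition _ : isFinite (intpart N) :=
  PCanIsFinite bseq_of_intpartK.

End IntPartFinite.

(* Parts are listed in weakly decreasing order, so the head is the largest. *)
Definition largest_part (s : seq nat) : nat := head 0 s.

Definition rank (s : seq nat) : int :=
  ((largest_part s)%:Z - (size s)%:Z)%R.

Definition rogers_ramanujan (s : seq nat) : bool :=
  pairwise (fun x y => y + 2 <= x) s.

Definition L (m N : nat) : nat :=
  #|[set p : intpart N | (size p == m) &&
      (largest_part p <= count_mem (largest_part p) p)]|.

Definition R (k : int) (N : nat) : nat :=
  #|[set p : intpart N | rogers_ramanujan p && (rank p == k)]|.

(* Main.v *)
(** A partition whose largest part [n] occurs at least [n] times is the
    conjugate of a partition [c] with [n] parts, all of them at least [n].
    Replacing each part [c_i] ([0 <= i < n]) by [c_i + n - (2 i + 1)] keeps the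
    sum, since [1 + 3 + ... + (2 n - 1) = n ^ 2], and turns these [c] exactly
    into the Rogers--Ramanujan partitions with [n] parts; as the largest part
    of [c] is the number [m] of parts of its conjugate, the rank obtained is
    [(m + n - 1) - n = m - 1]. *)
Require Import Defs.
From mathcomp Require Import all_boot all_order all_algebra.
From mathcomp Require Import zify.

Set Implicit Arguments.
Unset Strict Implicit.

(** The left inverse [g] makes [f] injective on [P]. The maps act on bare sequences, so no proof of
    being a partition is carried through them. *)
Lemma leq_card_intpart (N : nat) (P Q : pred (seq nat)) (f g : seq nat -> seq nat) :
    (forall s, is_intpart N s -> P s ->
       [/\ is_intpart N (f s), Q (f s) & g (f s) = s]) ->
  #|[set p : intpart N | P p]| <= #|[set p : intpart N | Q p]|.
Proof.
move=> fP; pose F (p : intpart N) : intpart N := insubd p (f p).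
have valF (p : intpart N) : P p -> val (F p) = f p.
  by move=> Pp; rewrite insubdK // unfold_in; case: (fP p (valP p) Pp).
rewrite -(card_in_imset (f := F)) => [|p q].
  apply/subset_leq_card/subsetP => _ /imsetP[p + ->]; rewrite !inE => Pp.
  by rewrite (valF p Pp : parts (F p) = _); case: (fP p (valP p) Pp).
rewrite !inE => Pp Pq /(congr1 val); rewrite !valF // => eq_f.
have [_ _ gp] := fP p (valP p) Pp; have [_ _ gq] := fP q (valP q) Pq.
by apply: val_inj; rewrite /= -gp eq_f gq.
Qed.

(** * Conjugation of partitions *)

Definition conjugate (s : seq nat) : seq nat :=
  mkseq (fun i => count (fun x => i < x) s) (head 0 s).

Lemma sumn_mkseq f n : sumn (mkseq f n) = \sum_(0 <= i < n) f i.
Proof. by rewrite sumnE big_map /index_iota subn0. Qed.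

Lemma sumn_nth s : sumn s = \sum_(0 <= i < size s) nth 0 s i.
Proof. by rewrite sumnE (big_nth 0). Qed.

Lemma sorted_geq_nth (s : seq nat) i j :
  sorted geq s -> i <= j -> nth 0 s j <= nth 0 s i.
Proof.
move=> s_sorted le_ij; case: (ltnP j (size s)) => [lt_j|ge_j]; last first.
  by rewrite nth_default.
have geq_trans : transitive geq by move=> a b c /= ba ac; apply: leq_trans ac ba.
by apply: (sorted_leq_nth geq_trans (leqnn : reflexive geq));
  rewrite ?inE // (leq_ltn_trans le_ij).
Qed.

(** The entries exceeding [i] form a prefix of [s]. Both sides say that the Young diagram has a cell
    in row [j] and column [i]; past the end, the default 0 agrees. *)
Lemma ltn_count_sorted (s : seq nat) i j :
  sorted geq s -> (j < count (fun x => i < x) s) = (i < nth 0 s j).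
Proof.
elim: s j => [|x s IHs] j s_sorted; first by rewrite nth_nil.
have x_max k : nth 0 s k <= x by apply: (@sorted_geq_nth (x :: s) 0 k.+1).
have {}IHs := IHs _ (path_sorted s_sorted).
case: j => [|j] /=; last first.
  case: (ltnP i x) => [_|le_xi]; first by rewrite add1n ltnS IHs.
  rewrite add0n; have := IHs j.+1; have := x_max j; have := x_max j.+1; lia.
case: (ltnP i x) => // le_xi; rewrite add0n IHs; have := x_max 0; lia.
Qed.

Lemma size_conjugate s : size (conjugate s) = head 0 s.
Proof. exact: size_mkseq. Qed.

Lemma nth_conjugate s i :
  sorted geq s -> nth 0 (conjugate s) i = count (fun x => i < x) s.
Proof.
move=> s_sorted; case: (ltnP i (head 0 s)) => [|le_i]; first exact: nth_mkseq.
rewrite nth_default ?size_conjugate //.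
by have := ltn_count_sorted i 0 s_sorted; rewrite nth0; lia.
Qed.

Lemma sorted_conjugate s : sorted geq s -> sorted geq (conjugate s).
Proof.
move=> s_sorted; apply/(sortedP 0) => i _; rewrite /= !nth_conjugate //.
by apply: sub_count => x /= /ltnW.
Qed.

Lemma notin0_conjugate s : sorted geq s -> 0 \notin conjugate s.
Proof.
move=> s_sorted; apply/negP => /(nthP 0)[i]; rewrite size_conjugate => lt_i.
by have := ltn_count_sorted i 0 s_sorted; rewrite nth_conjugate // nth0; lia.
Qed.

Lemma head_conjugate s :
  sorted geq s -> 0 \notin s -> head 0 (conjugate s) = size s.
Proof.
move=> s_sorted s_gt0; rewrite -nth0 nth_conjugate //.
apply/eqP; rewrite -all_count; apply/allP => x xs.
by rewrite lt0n; apply: contraNneq s_gt0 => <-.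
Qed.

(** Double counting of the cells of the diagram, by columns and by rows. *)
Lemma sumn_conjugate s : sorted geq s -> sumn (conjugate s) = sumn s.
Proof.
move=> s_sorted; rewrite sumn_mkseq [RHS]sumnE.
under eq_bigr => i _ do rewrite -sum1_count big_mkcond.
rewrite exchange_big /=; apply: eq_big_seq => x /(nthP 0)[k _ <-].
have le_h : nth 0 s k <= head 0 s by rewrite -nth0 sorted_geq_nth.
(* Columns below the value of the part contribute 1 each, the remaining ones 0. *)
rewrite (big_cat_nat (leq0n _) le_h) //= [X in _ + X]big_nat_cond.
rewrite [X in _ + X]big1 => [|i]; last by case/andP=> /andP[/leq_gtF ->].
rewrite addn0 -[RHS]muln1 -[X in _ = X * _]subn0 -sum_nat_const_nat.
by apply: eq_big_nat => i /= ->.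
Qed.

(** Transposing a cell twice restores it, so corresponding entries exceed the same numbers [i] and
    are equal. *)
Lemma conjugateK s : sorted geq s -> 0 \notin s -> conjugate (conjugate s) = s.
Proof.
move=> s_sorted s_gt0; have c_sorted := sorted_conjugate s_sorted.
apply: (@eq_from_nth _ 0) => [|j _]; first by rewrite size_conjugate head_conjugate.
have lt_nth i : (i < nth 0 (conjugate (conjugate s)) j) = (i < nth 0 s j).
  by rewrite nth_conjugate // ltn_count_sorted // nth_conjugate // ltn_count_sorted.
apply/eqP; rewrite eqn_leq; have := lt_nth (nth 0 s j).
by have := lt_nth (nth 0 (conjugate (conjugate s)) j); lia.
Qed.

Lemma conjugate_intpart N s : is_intpart N s -> is_intpart N (conjugate s).
Proof.
case/and3P=> s_sorted s_gt0 sum_s; apply/and3P; split.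
- exact: sorted_conjugate.
- exact: notin0_conjugate.
- by rewrite sumn_conjugate.
Qed.

(** It suffices to bound the last, hence smallest, entry of the conjugate. It counts the parts
    exceeding [n - 1], which are those equal to the largest part [n]. *)
Lemma conjugate_all_ge_size s : sorted geq s ->
  all (leq (size (conjugate s))) (conjugate s) = (head 0 s <= count_mem (head 0 s) s).
Proof.
move=> s_sorted; rewrite size_conjugate; set n := head 0 s.
case: (posnP n) => [->|n_gt0]; first by apply/allP.
have <- : nth 0 (conjugate s) n.-1 = count_mem n s.
  rewrite nth_conjugate //; apply: eq_in_count => x /(nthP 0)[k _ <-] /=.
  by have := sorted_geq_nth s_sorted (leq0n k); rewrite nth0 -/n; lia.
apply/(all_nthP 0)/idP => [|le_n i]; rewrite size_conjugate -/n.
  by apply; rewrite prednK.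
move=> lt_i; apply: leq_trans le_n _.
by apply: sorted_geq_nth; [exact: sorted_conjugate | lia].
Qed.

(** * The shift by odd numbers *)

Definition spread (s : seq nat) : seq nat :=
  mkseq (fun i => nth 0 s i + size s - (2 * i + 1)) (size s).

Definition unspread (s : seq nat) : seq nat :=
  mkseq (fun i => nth 0 s i + (2 * i + 1) - size s) (size s).

Lemma sum_odd n : \sum_(0 <= i < n) (2 * i + 1) = n * n.
Proof. by elim: n => [|n IHn]; rewrite ?big_nil // big_nat_recr //= IHn; lia. Qed.

Lemma sumn_spread s : all (leq (size s)) s -> sumn (spread s) = sumn s.
Proof.
(* The added square is a sum of odd numbers on the left and a sum of copies of [size s] on the
   right. The terms then agree, as [ge_s] makes the truncated subtraction exact. *)
move/(all_nthP 0) => ge_s; apply/eqP; rewrite -(eqn_add2r (size s * size s)).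
rewrite -{1}sum_odd -[X in _ == _ + X * _]subn0 -sum_nat_const_nat.
rewrite sumn_mkseq sumn_nth -!big_split /=.
by apply/eqP/eq_big_nat => i /= lt_i; have := ge_s i lt_i; lia.
Qed.

(** The last part is at least 1 and each step to the left adds at least 2. This makes the
    subtraction in [unspread] exact and its values at least [size s]. *)
Lemma rogers_ramanujan_nth_ge s i : rogers_ramanujan s -> 0 \notin s -> i < size s ->
  2 * size s <= nth 0 s i + (2 * i + 1).
Proof.
move=> rr s_gt0 lt_i.
have s_sorted : sorted (fun x y => y + 2 <= x) s by apply: pairwise_sorted.
move/(sortedP 0): s_sorted => step.
(* [k] is the number of parts after index [i]; the induction starts at the last part. *)
have [k def_k] : {k | size s = i + k.+1} by exists (size s - i.+1); lia.
elim: k => [|k IHk] in i lt_i def_k *.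
  have : nth 0 s i != 0 by apply: contraNneq s_gt0 => <-; apply: mem_nth.
  lia.
have lt_i1 : i.+1 < size s by lia.
have := IHk i.+1 lt_i1; have := step i lt_i1; lia.
Qed.

Lemma sumn_unspread s : rogers_ramanujan s -> 0 \notin s ->
  sumn (unspread s) = sumn s.
Proof.
move=> rr s_gt0; apply/eqP; rewrite -(eqn_add2r (size s * size s)).
rewrite -{1}[size s]subn0 -sum_nat_const_nat -sum_odd.
rewrite sumn_mkseq sumn_nth -!big_split /=.
by apply/eqP/eq_big_nat => i /= lt_i; have := rogers_ramanujan_nth_ge rr s_gt0 lt_i; lia.
Qed.

Lemma nth_spread s i :
  i < size s -> nth 0 (spread s) i = nth 0 s i + size s - (2 * i + 1).
Proof. exact: nth_mkseq. Qed.

Lemma nth_unspread s i :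
  i < size s -> nth 0 (unspread s) i = nth 0 s i + (2 * i + 1) - size s.
Proof. exact: nth_mkseq. Qed.

Lemma spreadK s : all (leq (size s)) s -> unspread (spread s) = s.
Proof.
move/(all_nthP 0) => ge_s; apply: (@eq_from_nth _ 0) => [|i].
  by rewrite !size_mkseq.
rewrite !size_mkseq => lt_i; rewrite nth_unspread ?size_mkseq // nth_spread //.
by have := ge_s i lt_i; lia.
Qed.

Lemma unspreadK s :
  rogers_ramanujan s -> 0 \notin s -> spread (unspread s) = s.
Proof.
move=> rr s_gt0; apply: (@eq_from_nth _ 0) => [|i]; first by rewrite !size_mkseq.
rewrite !size_mkseq => lt_i; rewrite nth_spread ?size_mkseq // nth_unspread //.
by have := rogers_ramanujan_nth_ge rr s_gt0 lt_i; lia.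
Qed.

(** * From conjugates to Rogers--Ramanujan partitions *)

Lemma rogers_ramanujan_sorted s :
  rogers_ramanujan s = sorted (fun x y => y + 2 <= x) s.
Proof. by rewrite sorted_pairwise // => y x z /=; lia. Qed.

(** Among partitions of [N], this characterises the conjugates of those counted by [L m N]. *)
Definition wide (m : nat) (s : seq nat) : bool :=
  (head 0 s == m) && all (leq (size s)) s.

Lemma spread_wide m N s : 0 < N -> is_intpart N s -> wide m s ->
  [/\ is_intpart N (spread s),
      rogers_ramanujan (spread s) && (rank (spread s) == m%:Z - 1)%R
    & unspread (spread s) = s].
Proof.
move=> N_gt0 /and3P[s_sorted s_gt0 /eqP sum_s] /andP[/eqP head_s all_s].
have /(all_nthP 0) ge_s := all_s.
(* Since [N] is positive, there is a first part, from which the rank is computed. *)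
have s_pos : 0 < size s by case: (s) sum_s => //=; lia.
(* The shift falls by 2 at each index while [s] does not increase. *)
have step i : i.+1 < size s -> nth 0 (spread s) i.+1 + 2 <= nth 0 (spread s) i.
  move=> lt_i; rewrite !nth_spread ?(ltnW lt_i) //.
  have := sorted_geq_nth s_sorted (leqnSn i).
  by have := ge_s _ lt_i; lia.
split; last exact: spreadK.
  apply/and3P; split; last by rewrite sumn_spread // sum_s.
    by apply/(sortedP 0) => i; rewrite size_mkseq => /step /=; lia.
  apply/negP => /(nthP 0)[i]; rewrite size_mkseq => lt_i; rewrite nth_spread //.
  by have := ge_s _ lt_i; lia.
apply/andP; split.
  rewrite rogers_ramanujan_sorted; apply/(sortedP 0) => i.
  by rewrite size_mkseq => /step.
rewrite /rank /largest_part -nth0 nth_spread // size_mkseq nth0 head_s; lia.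
Qed.

Lemma unspread_wide m N s : 0 < N -> is_intpart N s ->
    rogers_ramanujan s && (rank s == m%:Z - 1)%R ->
  [/\ is_intpart N (unspread s), wide m (unspread s)
    & spread (unspread s) = s].
Proof.
move=> N_gt0 /and3P[s_sorted s_gt0 /eqP sum_s] /andP[rr rank_s].
have s_pos : 0 < size s by case: (s) sum_s => //=; lia.
have ge_s i : i < size s -> size s <= nth 0 (unspread s) i.
  by move=> lt_i; rewrite nth_unspread //; have := rogers_ramanujan_nth_ge rr s_gt0 lt_i; lia.
split; last exact: unspreadK.
  apply/and3P; split; last by rewrite sumn_unspread // sum_s.
    apply/(sortedP 0) => i; rewrite size_mkseq => lt_i.
    rewrite /= !nth_unspread ?(ltnW lt_i) //.
    (* The gap of 2 absorbs the growth of [2 * i + 1]. *)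
    move: (rr); rewrite rogers_ramanujan_sorted => /(sortedP 0)/(_ i lt_i); lia.
  by apply/negP => /(nthP 0)[i]; rewrite size_mkseq => /ge_s + eq0; rewrite eq0; lia.
apply/andP; split; last first.
  by apply/(all_nthP 0) => i; rewrite size_mkseq => /ge_s.
rewrite -nth0 nth_unspread // nth0; move: rank_s (rogers_ramanujan_nth_ge rr s_gt0 s_pos).
rewrite /rank /largest_part nth0; lia.
Qed.

Lemma wide_conjugate m s : sorted geq s -> 0 \notin s ->
  wide m (conjugate s) =
  (size s == m) && (largest_part s <= count_mem (largest_part s) s).
Proof.
by move=> s_sorted s_gt0; rewrite /wide head_conjugate // conjugate_all_ge_size.
Qed.

Theorem theorem2p1 (m N : nat) (hN : 0 < N) : L m N = R (m%:Z - 1)%R N.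
Proof.
pose P s := (size s == m) && (largest_part s <= count_mem (largest_part s) s).
pose Q s := rogers_ramanujan s && (rank s == m%:Z - 1)%R.
apply/eqP; rewrite eqn_leq; apply/andP; split.
  apply: (@leq_card_intpart N P Q (spread \o conjugate) (conjugate \o unspread)).
  move=> s part_s Ps; have /and3P[s_sorted s_gt0 _] := part_s.
  have wide_s : wide m (conjugate s) by rewrite wide_conjugate.
  have [? ? /= ->] := spread_wide hN (conjugate_intpart part_s) wide_s.
  by split=> //; apply: conjugateK.
apply: (@leq_card_intpart N Q P (conjugate \o unspread) (spread \o conjugate)).
move=> s part_s /(unspread_wide hN part_s)[part_u wide_u uK].
have /and3P[u_sorted u_gt0 _] := part_u.
split; rewrite /= ?conjugateK //; first exact: conjugate_intpart.
(* [unspread s] is the conjugate of its own conjugate, so [wide_u] gives [P] of that conjugate. *)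
by rewrite /P -wide_conjugate ?conjugateK ?sorted_conjugate ?notin0_conjugate.
Qed.
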